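(* Let $A\subset B$ be an extension of commutative rings with unity and let $M\subset N$ be an extension of positive monoids (all monoids being commutative, cancellative and torsion-free) such that $A$ is subintegrally closed in $B$ and $M$ is subintegrally closed in $N$. (i) If $B$ is reduced or $M=N$, then $A[M]$ is subintegrally closed in $B[N]$. (ii) Conversely, if $A[M]$ is subintegrally closed in $B[N]$ and $N$ is affine, then $B$ is reduced or $M=N$.
   Context: All rings are commutative with unity. All monoids are commutative, cancellative and torsion-free (if $x^n=y^n$ for some $n\ge 1$ then $x=y$), written multiplicatively. A monoid is positive if its group of units is trivial, and affine if it is finitely generated. $A[M]$ denotes the monoid algebra. Subintegrality for rings: an extension $A\subset B$ is elementary subintegral if $B=A[b]$ for some $b$ with $b^2,b^3\in A$; it is subintegral if $B$ is a union of subrings obtained from $A$ by finite successions of elementary subintegral extensions. The subintegral closure of $A$ in $B$ is the largest subintegral extension of $A$ in $B$, and $A$ is subintegrally closed in $B$ if it equals its subintegral closure in $B$. Subintegrality for monoids: an extension $M\subset N$ is elementary subintegral if $N=M\cup xM$ for some $x$ with $x^2,x^3\in M$; it is subintegral if $N$ is a union of submonoids obtained from $M$ by finite successions of elementary subintegral extensions. The subintegral closure of $M$ in $N$ is the largest subintegral extension of $M$ in $N$, and $M$ is subintegrally closed in $N$ if it equals its subintegral closure in $N$. *)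

(* Defs.v *)
From HB Require Import structures.
From mathcomp Require Import all_boot all_algebra.
From mathcomp Require Import boolp classical_sets.
From mathcomp Require Import finmap monalg.

Set Implicit Arguments.
Unset Strict Implicit.
Unset Printing Implicit Defensive.

Import GRing.Theory.

Local Open Scope classical_set_scope.
Local Open Scope ring_scope.

(* An extension is a subset of an ambient structure: A of a ring B, M of a    *)
(* monoid N. Monoids are [conomType]s: this structure is commutative and its  *)
(* axiom [unitm] (x * y = 1 -> x = 1 /\ y = 1) is exactly positivity.         *)

(* [sub] is the class of substructures of the ambient T, and [elem X Y] says  *)
(* that Y is an elementary subintegral extension of X.                        *)
Section Subintegral.
Context {T : Type} (sub : set (set T)) (elem : set T -> set T -> Prop).

Inductive elem_succession (X : set T) : set T -> Prop :=
| ElemSuccessionNil : elem_succession X X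
| ElemSuccessionCons Y Z :
    elem_succession X Y -> elem Y Z -> elem_succession X Z.

Definition subintegral (X Y : set T) : Prop :=
  [/\ sub Y, X `<=` Y &
      exists F : set (set T),
        F `<=` elem_succession X /\ Y = \bigcup_(Z in F) Z].

Definition is_subintegral_closure (X C : set T) : Prop :=
  subintegral X C /\ forall Y, subintegral X Y -> Y `<=` C.

Definition subintegrally_closed (X : set T) : Prop :=
  is_subintegral_closure X X.

End Subintegral.

Section Rings.
Context {B : comPzRingType}.

Definition subring : set (set B) := [set A | GRing.subring_closed [in A]].

Definition ring_adjoin (A : set B) (b : B) : set B :=
  smallest subring (A `|` [set b]).

Definition ring_elem_subintegral (A C : set B) : Prop :=
  exists b : B, [/\ A (b ^+ 2), A (b ^+ 3) & C = ring_adjoin A b].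

Definition ring_subintegrally_closed : set B -> Prop :=
  subintegrally_closed subring ring_elem_subintegral.

End Rings.

Definition reduced (B : comPzRingType) : Prop :=
  forall (b : B) (n : nat), b ^+ n = 0 -> b = 0.

Section Monoids.
Context {N : conomType}.

Definition mexp (x : N) (n : nat) : N := iterop n mmul x mone.

Definition submonoid : set (set N) :=
  [set M | M mone /\ forall x y, M x -> M y -> M (mmul x y)].

Definition monoid_elem_subintegral (M P : set N) : Prop :=
  exists x : N, [/\ M (mexp x 2), M (mexp x 3) & P = M `|` (mmul x @` M)].

Definition monoid_subintegrally_closed : set N -> Prop :=
  subintegrally_closed submonoid monoid_elem_subintegral.

End Monoids.

Definition cancellative (N : conomType) : Prop :=
  forall x y z : N, mmul x y = mmul x z -> y = z.

Definition torsion_free (N : conomType) : Prop :=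
  forall (x y : N) (n : nat), (0 < n)%N -> mexp x n = mexp y n -> x = y.

Definition affine (N : conomType) : Prop :=
  exists s : seq N, smallest submonoid [set` s] = setT.

(* The ring structure on {malg B[N]} in [monalg] needs 1 != 0 in B. The alias *)
(* below has the same elements, unit and product, and also covers the zero    *)
(* ring; the ring laws come from [monalg] when B is not the zero ring.        *)
Definition monoid_algebra (B : comPzRingType) (N : conomType) : Type :=
  {malg B[N]}.

Section MonoidAlgebra.
Context (B : comPzRingType) (N : conomType).
Implicit Types f g h : {malg B[N]}.

Definition ma_one : {malg B[N]} := mkmalgU mone 1.

Definition ma_mul f g : {malg B[N]} :=
  \sum_(x <- msupp f) \sum_(y <- msupp g)
    mkmalgU (mmul x y) (mcoeff x f * mcoeff y g).

Let trivial_malg : (1 : B) = 0 -> forall f g, f = g.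
Proof.
move=> B0 f g; apply/malgP => k.
by rewrite -[LHS]mul1r -[RHS]mul1r B0 !mul0r.
Qed.

Let nzB (B1 : (1 : B) != 0) : comNzRingType :=
  HB.pack (GRing.ComPzRing.sort B)
    (GRing.PzSemiRing_isNonZero.Build (GRing.ComPzRing.sort B) B1).

Fact ma_mulA : associative ma_mul.
Proof.
move=> f g h; have [B0|B1] := eqVneq (1 : B) 0; first exact: trivial_malg.
exact: (@mulrA ({malg (nzB B1)[N]})).
Qed.

Fact ma_mulC : commutative ma_mul.
Proof.
move=> f g; have [B0|B1] := eqVneq (1 : B) 0; first exact: trivial_malg.
exact: (@mulrC ({malg (nzB B1)[N]})).
Qed.

Fact ma_mul1 : left_id ma_one ma_mul.
Proof.
move=> f; have [B0|B1] := eqVneq (1 : B) 0; first exact: trivial_malg.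
exact: (@mul1r ({malg (nzB B1)[N]})).
Qed.

Fact ma_mulDl : left_distributive ma_mul +%R.
Proof.
move=> f g h; have [B0|B1] := eqVneq (1 : B) 0; first exact: trivial_malg.
exact: (@mulrDl ({malg (nzB B1)[N]})).
Qed.

HB.instance Definition _ := GRing.Zmodule.on (monoid_algebra B N).
HB.instance Definition _ := GRing.Zmodule_isComPzRing.Build
  (monoid_algebra B N) ma_mulA ma_mulC ma_mul1 ma_mulDl.

End MonoidAlgebra.

Fact ma_mulE (B : comNzRingType) (N : conomType) (f g : {malg B[N]}) :
  ma_mul f g = f * g.
Proof. by []. Qed.

(* A[M] inside B[N]: coefficients in A, support in M. *)
Definition sub_monoid_algebra (B : comPzRingType) (N : conomType)
    (A : set B) (M : set N) : set (monoid_algebra B N) :=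
  [set f : {malg B[N]} | f \is a monalgOver [in A] /\ [set` msupp f] `<=` M].

(* Main.v *)
Require Import Defs.
From mathcomp Require Import all_boot all_algebra.
From mathcomp Require Import boolp classical_sets.
From mathcomp Require Import finmap monalg.

(* Fix a total order on N compatible with the product (Levi). Both cases of   *)
(* (i) concern the graded subring of the f such that each coefficient f_x is  *)
(* in A, and vanishes unless x is in M; the hypotheses say that a homogeneous *)
(* element is in it as soon as its square and cube are. If f^2 and f^3 are in *)
(* it, so are the square and cube of the leading term u of f, hence u. From   *)
(* f * f^2 = f^3, where f^2 has leading term u^2, u^k f is in it for some k.  *)
(* If k > 0 put g = u^(k-1) f: as u g is in the subring, so are the square    *)
(* and cube of g - u^k, which has fewer terms than f, so by induction g is in *)
(* it; now decrease k to 0.                                                   *)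
(* For (ii), if b <> 0, b^2 = 0 and x is not in M, then the square and cube   *)
(* of the element b x outside A[M] vanish.                                    *)

Set Implicit Arguments.
Unset Strict Implicit.
Unset Printing Implicit Defensive.

Import GRing.Theory.

Local Open Scope classical_set_scope.
Local Open Scope ring_scope.

(** Closedness is a condition on single elements: whatever has its square and cube in the
    substructure lies in it ([ring_subintegrally_closedP], [monoid_subintegrally_closed_mem]). A[M]
    is graded, with component A in the degrees of M and 0 elsewhere. If the square and cube of b x
    lie in it, then b is in A; when b is nonzero and B is reduced, b^2 and b^3 are nonzero, so x^2
    and x^3 are in M, hence x is too. [graded_mem] passes from homogeneous elements to all elements,
    with leading terms taken for the order of [exists_total_order]. It rests on [lead_power_mul],
    which places f in the subring up to a power of its leading term u, and on [subring_descent],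
    which removes one factor u at a time. *)

Local Notation "x * y" := (mmul x y) : monom_scope.
Local Notation "1" := mone : monom_scope.

(** * Reduction of closedness to one elementary step *)

Section SubintegrallyClosed.
Context {T : Type} (sub : set (set T)) (elem : set T -> set T -> Prop).

Lemma subintegrally_closed_elem X Y :
  subintegrally_closed sub elem X -> elem X Y -> sub Y -> X `<=` Y -> Y `<=` X.
Proof.
move=> [_ maxX] elemXY subY XY; apply: maxX; split=> //.
exists [set Y]; split; last by rewrite bigcup_set1.
move=> _ ->; exact: ElemSuccessionCons (ElemSuccessionNil _ _) elemXY.
Qed.

Lemma elem_subintegrally_closed X :
  sub X -> (forall Y, elem X Y -> Y = X) -> subintegrally_closed sub elem X.
Proof.
move=> subX elemX; split.
  split=> //; exists [set X]; split; last by rewrite bigcup_set1.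
  by move=> _ ->; exact: ElemSuccessionNil.
move=> _ [_ _ [F [FX ->]]] t [Y /FX XY].
have -> // : Y = X by elim: XY => // {}Y Z _ -> /elemX.
Qed.

End SubintegrallyClosed.

(** * Subrings: squares and cubes, inverting an element *)

Section SubringTheory.
Context {R : comPzRingType} (A : set R) (subA : subring A).

Lemma subring1 : A 1.
Proof. by case: subA => /set_mem. Qed.

Lemma subringB a b : A a -> A b -> A (a - b).
Proof.
by case: subA => _ AB _ /mem_set Aa /mem_set Ab; apply: set_mem; exact: AB.
Qed.

Lemma subringM a b : A a -> A b -> A (a * b).
Proof.
by case: subA => _ _ AM /mem_set Aa /mem_set Ab; apply: set_mem; exact: AM.
Qed.

Lemma subring0 : A 0.
Proof. by rewrite -(subrr 1); apply: subringB; exact: subring1. Qed.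

Lemma subringN a : A a -> A (- a).
Proof. by rewrite -sub0r; apply: subringB; exact: subring0. Qed.

Lemma subringD a b : A a -> A b -> A (a + b).
Proof. by move=> Aa Ab; rewrite -[b]opprK; apply/subringB/subringN. Qed.

Lemma subringX a n : A a -> A (a ^+ n).
Proof.
move=> Aa; elim: n => [|n IH]; first exact: subring1.
by rewrite exprS; exact: subringM.
Qed.

Lemma subring_sqr_cubeB v g : A v -> A (v * g) -> A (g ^+ 2) -> A (g ^+ 3) ->
  A ((g - v) ^+ 2) /\ A ((g - v) ^+ 3).
Proof.
move=> Av Avg Ag2 Ag3; have Av2 := subringX 2 Av.
have Avg2 : A (v * g + v * g) by exact: subringD.
have sqE : (g - v) ^+ 2 = g ^+ 2 - (v * g + v * g - v ^+ 2).
  by rewrite sqrrB mulr2n mulrC opprB addrA addrAC.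
have Asq : A ((g - v) ^+ 2) by rewrite sqE; do 2?apply: subringB.
split=> //; rewrite exprS mulrBl; apply: subringB; last exact: subringM.
rewrite sqE mulrBr -exprS; apply: subringB => //.
rewrite mulrBr mulrDr mulrCA -expr2 [g * v ^+ 2]mulrC [v ^+ 2]expr2 -mulrA.
by apply: subringB; [apply: subringD|]; exact: subringM.
Qed.

(** With g = u^k f and v = u^(k+1), the product v g = u^k (u^(k+1) f) is in A, so
    [subring_sqr_cubeB] applies to g - v = u^k (f - u). The last hypothesis is to be supplied by
    induction on the number of terms. *)
Lemma subring_descent u f k :
  A u -> A (f ^+ 2) -> A (f ^+ 3) -> A (u ^+ k.+1 * f) ->
  (A ((u ^+ k * (f - u)) ^+ 2) -> A ((u ^+ k * (f - u)) ^+ 3) ->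
   A (u ^+ k * (f - u))) ->
  A (u ^+ k * f).
Proof.
move=> Au Af2 Af3 Auf; have AX i : A (u ^+ i) by exact: subringX.
have -> : u ^+ k * (f - u) = u ^+ k * f - u ^+ k.+1 by rewrite mulrBr exprSr.
set g := u ^+ k * f => Ah.
have Avg : A (u ^+ k.+1 * g) by rewrite /g mulrCA; exact: subringM.
have Ag i : A (f ^+ i) -> A (g ^+ i).
  by move=> Afi; rewrite exprMn; apply: subringM => //; exact: subringX.
have [Ah2 Ah3] := subring_sqr_cubeB (AX k.+1) Avg (Ag _ Af2) (Ag _ Af3).
by rewrite -(subrK (u ^+ k.+1) g); apply: subringD => //; exact: Ah.
Qed.

(** For u in A, this is the preimage in R of A[1/u] under R -> R[1/u], stated without localizing; u
    may be a zero divisor. *)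
Definition power_conductor (u : R) : set R :=
  [set t | exists k, A (u ^+ k * t)].

Section PowerConductor.
Context (u : R) (Au : A u).
Local Notation Q := (power_conductor u).

Lemma power_conductor_sub t : A t -> Q t.
Proof. by move=> At; exists 0%N; rewrite expr0 mul1r. Qed.

Lemma power_conductorB s t : Q s -> Q t -> Q (s - t).
Proof.
move=> [k As] [l At]; exists (k + l)%N.
rewrite mulrBr {1}addnC !exprD -!mulrA.
by apply: subringB; apply: subringM => //; exact: subringX.
Qed.

Lemma power_conductorD s t : Q s -> Q t -> Q (s + t).
Proof.
move=> Qs Qt; rewrite -[t]opprK -[- t]sub0r.
by do 2?apply: power_conductorB => //; exact/power_conductor_sub/subring0.
Qed.

Lemma power_conductor_sum (I : eqType) (r : seq I) (F : I -> R) :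
  (forall i, i \in r -> Q (F i)) -> Q (\sum_(i <- r) F i).
Proof.
move=> QF; rewrite big_seq; elim/big_ind: _ => //.
  exact/power_conductor_sub/subring0.
exact: power_conductorD.
Qed.

Lemma power_conductorM s t : Q s -> A t -> Q (s * t).
Proof. by move=> [k As] At; exists k; rewrite mulrA; exact: subringM. Qed.

Lemma power_conductor_cancel k t : Q (u ^+ k * t) -> Q t.
Proof. by move=> [l At]; exists (l + k)%N; rewrite exprD -mulrA. Qed.

End PowerConductor.

(** [ring_adjoin A b] is elementary over A, so a closed A absorbs it; conversely, if every
    elementary step from A is trivial, no succession of them leaves A. *)
Lemma ring_subintegrally_closedP :
  ring_subintegrally_closed A <->
  (forall b, A (b ^+ 2) -> A (b ^+ 3) -> A b).
Proof.
split=> [closedA b Ab2 Ab3|closedA].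
  suff /(_ b) : ring_adjoin A b `<=` A by apply=> X [_]; apply; right.
  apply: (subintegrally_closed_elem closedA); first by exists b.
    split=> [|x y|x y].
    - by apply: mem_set => X [[/set_mem]].
    - move=> /set_mem Xx /set_mem Xy; apply: mem_set => X [subX AbX].
      case: (subX) => _ XB _; apply: set_mem; apply: XB; apply: mem_set.
        exact: Xx.
      exact: Xy.
    - move=> /set_mem Xx /set_mem Xy; apply: mem_set => X [subX AbX].
      case: (subX) => _ _ XM; apply: set_mem; apply: XM; apply: mem_set.
        exact: Xx.
      exact: Xy.
  by move=> a Aa X [_]; apply; left.
apply: elem_subintegrally_closed => // _ [b [Ab2 Ab3 ->]].
apply/seteqP; split.
  by apply: smallest_sub => // x [//|->]; exact: closedA.
by move=> a Aa X [_]; apply; left.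
Qed.

End SubringTheory.

(** * Submonoids and powers *)

Lemma monoid_subintegrally_closed_mem (N : conomType) (M : set N) (x : N) :
  submonoid M -> monoid_subintegrally_closed M ->
  M (x * x)%M -> M (x * (x * x))%M -> M x.
Proof.
move=> [M1 MM] closedM Mx2 Mx3.
suff /(_ x) : M `|` mmul x @` M `<=` M.
  by apply; right; exists mone => //; rewrite mulm1.
apply: (subintegrally_closed_elem closedM); first by exists x.
  split=> [|y z]; first by left.
  case=> [My|[y' My' <-]] [Mz|[z' Mz' <-]].
  - by left; exact: MM.
  - by right; exists (y * z')%M; [exact: MM|rewrite !mulmA (mulmC x y)].
  - by right; exists (y' * z)%M; [exact: MM|rewrite mulmA].
  (* (x y') (x z') = x^2 (y' z') falls back into M. *)
  - by left; rewrite Monoid.mulmACA; apply: (MM) => //; exact: MM.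
by move=> y My; left.
Qed.

Section Powers.
Context {N : conomType}.
Implicit Types x y : N.

Lemma mexpS x n : mexp x n.+1 = (x * mexp x n)%M.
Proof. by rewrite /mexp !Monoid.iteropE. Qed.

Lemma mexpD x m n : mexp x (m + n)%N = (mexp x m * mexp x n)%M.
Proof. by elim: m => [|m IH]; rewrite ?mul1m // addSn !mexpS IH mulmA. Qed.

Lemma mexpM x m n : mexp x (m * n)%N = mexp (mexp x m) n.
Proof. by elim: n => [|n IH]; rewrite ?muln0 // mulnS mexpD IH mexpS. Qed.

End Powers.

(** * Levi's theorem: translation-invariant total orders *)

Section TotalOrder.
Context {N : conomType} (cancelN : cancellative N).
Implicit Types (le : N -> N -> Prop) (x y z a b : N).

Definition translation_order le : Prop :=
  [/\ forall x, le x x, forall x y z, le x y -> le y z -> le x z,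
      forall x y, le x y -> le y x -> x = y &
      forall z x y, le (x * z)%M (y * z)%M <-> le x y].

(* Additively: [y - x = p + n (b - a)] with [p >= 0]. *)
Let adjoin_le le a b x y := exists n, le (x * mexp b n)%M (y * mexp a n)%M.

Lemma le_mexp le a b n :
  translation_order le -> le a b -> le (mexp a n) (mexp b n).
Proof.
move=> [le_refl le_trans _ leM] ab; elim: n => [//|n IH].
rewrite !mexpS; apply: (le_trans _ (b * mexp a n)%M); first exact/leM.
by rewrite !(mulmC b); exact/leM.
Qed.

(** Antisymmetry is where the hypothesis on powers enters: multiplying the inequalities for (x, y)
    and (y, x) and cancelling x y gives b^(m+n) <= a^(m+n), which forces m = n = 0. *)
Lemma adjoin_le_order le a b : translation_order le ->
  (forall n, (0 < n)%N -> ~ le (mexp b n) (mexp a n)) ->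
  translation_order (adjoin_le le a b).
Proof.
move=> [le_refl le_trans le_anti leM] not_ba; split.
- by move=> x; exists 0%N.
- move=> x y z [m xy] [n yz]; exists (m + n)%N; rewrite !mexpD.
  apply: (le_trans _ (y * mexp a m * mexp b n)%M).
    by rewrite mulmA; exact/leM.
  rewrite -mulmA (mulmC (mexp a m)) (mulmC (mexp a m)) !mulmA; exact/leM.
- move=> x y [m xy] [n yx].
  have [mn0|mn_gt0] := posnP (m + n).
    move: mn0 xy yx => /eqP; rewrite addn_eq0 => /andP[/eqP-> /eqP->].
    by rewrite !mulm1; exact: le_anti.
  case: (not_ba _ mn_gt0); rewrite !mexpD.
  apply/(leM (x * y)%M); apply: (le_trans _ (y * mexp a m * (y * mexp b n))%M).
    rewrite (_ : _ * _ = x * mexp b m * (y * mexp b n))%M; first exact/leM.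
    by rewrite mulmC !mulmA; congr (_ * _)%M; rewrite -!mulmA (mulmC y).
  rewrite (_ : (mexp a m * _ * _)%M = x * mexp a n * (y * mexp a m))%M;
    last first.
    rewrite mulmC (mulmC (mexp a m)) -!mulmA; congr (_ * _)%M.
    by rewrite !mulmA (mulmC y).
  by rewrite mulmC; exact/leM.
- move=> z x y; split=> -[n xy]; exists n; move: xy;
    by rewrite -![(_ * z * _)%M]mulmA !(mulmC z) !mulmA => /leM // ?; apply/leM.
Qed.

Lemma exists_total_order : torsion_free N ->
  exists le, translation_order le /\ forall x y, le x y \/ le y x.
Proof.
move=> torsionN.
(* Adding the diagonal lets Zorn's lemma handle the empty chain: its union yields equality, a
   [translation_order] by cancellation. *)
pose leX (X : set (N * N)) x y := x = y \/ X (x, y).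
pose P := [set X | translation_order (leX X)].
have /Zorn_bigcup[X [PX maxX]] : forall F : set (set (N * N)),
    F `<=` P -> total_on F subset -> P (\bigcup_(X in F) X).
  move=> F FP totF.
  have inF x y : leX (\bigcup_(X in F) X) x y ->
      x = y \/ exists2 X, F X & leX X x y.
    by case=> [|[X FX Xxy]]; [left|right; exists X => //; right].
  have outF X x y : F X -> leX X x y -> leX (\bigcup_(X in F) X) x y.
    by move=> FX [->|Xxy]; [left|right; exists X].
  have leS X Y x y : X `<=` Y -> leX X x y -> leX Y x y.
    by move=> XY [->|/XY]; [left|right].
  have inF2 x y z t : leX (\bigcup_(X in F) X) x y ->
    leX (\bigcup_(X in F) X) z t -> [\/ x = y, z = t |
      exists X, [/\ F X, leX X x y & leX X z t]].
    move=> /inF[->|[X FX Xxy]]; first by constructor 1.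
    move=> /inF[->|[Y FY Yzt]]; first by constructor 2.
    constructor 3; case: (totF _ _ FX FY) => [XY|YX].
      by exists Y; split=> //; exact: leS Xxy.
    by exists X; split=> //; exact: leS Yzt.
  split.
  - by left.
  - move=> x y z xy yz; case: (inF2 _ _ _ _ xy yz) => [->//|<-//|].
    move=> [X [FX Xxy Xyz]]; have [_ tr _ _] := FP _ FX.
    exact: (outF X) (tr _ _ _ Xxy Xyz).
  - move=> x y xy yx; case: (inF2 _ _ _ _ xy yx) => // -[X [FX Xxy Xyx]].
    by have [_ _ anti _] := FP _ FX; exact: anti.
  - move=> z x y; split=> /inF[|[X FX]].
    + by rewrite !(mulmC _ z) => /cancelN->; left.
    + by have [_ _ _ leM] := FP _ FX; move=> /leM; exact: outF.
    + by move=> ->; left.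
    + by have [_ _ _ leM] := FP _ FX; move=> /(leM z); exact: outF.
(* Otherwise [adjoin_le] would give a strictly larger order, against maximality. *)
have extX a b :
    (forall n, (0 < n)%N -> ~ leX X (mexp b n) (mexp a n)) -> leX X a b.
  move=> not_ba; pose Y := [set p | adjoin_le (leX X) a b p.1 p.2].
  have [refl tr anti leM] := adjoin_le_order PX not_ba.
  have YE x y : leX Y x y <-> adjoin_le (leX X) a b x y.
    by split=> [[->|]//|]; right.
  have PY : P Y.
    split=> [x|x y z|x y|z x y]; rewrite ?YE;
      [exact: refl|exact: tr|exact: anti|exact: leM].
  have [leXX _ _ _] := PX.
  right; apply: contrapT => Xab; apply: (maxX Y) => //; split.
    by move=> [x y] Xxy; exists 0%N; rewrite !mulm1; right.
  move=> /(_ (a, b)) YX; apply/Xab/YX; exists 1%N.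
  by rewrite /mexp /= mulmC; exact: leXX.
exists (leX X); split=> // a b; apply: contrapT => /not_orP[not_ab not_ba].
(* For an incomparable pair, b^m <= a^m and a^n <= b^n with m, n > 0, so a^(mn) = b^(mn), and a = b
   by torsion-freeness. *)
have [m m_gt0 ba] : exists2 m, (0 < m)%N & leX X (mexp b m) (mexp a m).
  apply: contrapT => no; apply: not_ab; apply: extX => n n_gt0 le_ba.
  by apply: no; exists n.
have [n n_gt0 ab] : exists2 n, (0 < n)%N & leX X (mexp a n) (mexp b n).
  apply: contrapT => no; apply: not_ba; apply: extX => k k_gt0 le_ab.
  by apply: no; exists k.
apply: not_ab; left; apply: (torsionN _ _ (m * n)%N).
  by rewrite muln_gt0 m_gt0.
have [_ _ anti _] := PX; apply: anti.
  by rewrite mulnC !mexpM; exact: le_mexp.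
by rewrite !mexpM; exact: le_mexp.
Qed.

End TotalOrder.

(** * Monomials and products in the monoid algebra *)

Section MonoidAlgebraTheory.
Context {B : comPzRingType} {N : conomType}.
Local Notation R := (monoid_algebra B N).
Implicit Types (f g : R) (x y z : N) (a b : B).

Definition mono a x : R := mkmalgU x a.

Lemma mcoeff_maM f g z :
  mcoeff z (f * g : R) =
  \sum_(x <- msupp f) \sum_(y <- msupp g)
    (mcoeff x f * mcoeff y g) *+ (x * y == z)%M.
Proof.
rewrite [LHS]raddf_sum /=; apply: eq_bigr => x _.
by rewrite raddf_sum /=; apply: eq_bigr => y _; rewrite mcoeffU.
Qed.

Lemma msupp_maM f g z : z \in msupp (f * g : R) ->
  exists x y, [/\ x \in msupp f, y \in msupp g & z = (x * y)%M].
Proof.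
apply: contraPP => not_xy; apply/negP; rewrite -mcoeff_eq0 mcoeff_maM.
rewrite big_seq big1 // => x xf; rewrite big_seq big1 // => y yg.
by case: eqP => // xyz; case: not_xy; exists x, y.
Qed.

Lemma ma_sum_mono f : f = \sum_(x <- msupp f) mono (mcoeff x f) x.
Proof. exact: monalgE. Qed.

Lemma monoM a b x y : mono a x * mono b y = mono (a * b) (x * y)%M.
Proof.
apply/malgP => z; rewrite mcoeff_maM !msuppU mcoeffU.
have [->|_] := eqVneq a 0; first by rewrite big_seq_fset0 mul0r mul0rn.
have [->|_] := eqVneq b 0; first by
  rewrite big_seq_fset1 big_seq_fset0 mulr0 mul0rn.
by rewrite !big_seq_fset1 !mcoeffUU.
Qed.

Lemma mcoeff_monoM (cancelN : cancellative N) a y g w :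
  mcoeff (y * w)%M (mono a y * g) = a * mcoeff w g.
Proof.
rewrite mcoeff_maM msuppU.
have [->|_] := eqVneq a 0; first by rewrite big_seq_fset0 mul0r.
rewrite big_seq_fset1 mcoeffUU.
have yw x : (y * x == y * w)%M = (x == w).
  by apply/eqP/eqP => [/cancelN|->].
case: (msuppP g w) => [wg|wg].
  rewrite (big_fsetD1 w) //= eqxx big1_fset ?addr0 // => x.
  by rewrite in_fsetD1 yw => /andP[/negbTE-> _].
rewrite mulr0 big1_fset // => x xg _; rewrite yw.
by case: eqP xg wg => // -> ->.
Qed.

Lemma card_msupp_monoM a x f : (#|` msupp (mono a x * f)%R| <= #|` msupp f|)%N.
Proof.
apply: (@leq_trans #|` [fset (x * y)%M | y in msupp f]%fset|).
  apply/fsubset_leq_card/fsubsetP => _ /msupp_maM[x' [y [x'x yf ->]]].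
  apply/imfsetP; exists y => //=.
  by move: x'x => /(fsubsetP msuppU_le); rewrite inE => /eqP->.
exact: leq_imfset_card.
Qed.

End MonoidAlgebraTheory.

(** * Graded subrings: from homogeneous to arbitrary elements *)

Section GradedSubring.
Context {B : comPzRingType} {N : conomType}.
Local Notation R := (monoid_algebra B N).
Implicit Types (f g : R) (x y z : N) (a b : B).

Context (S : N -> set B).

Definition graded_set : set R := [set f : R | forall x, S x (mcoeff x f)].

Hypothesis S1 : S 1%M 1.
Hypothesis S0 : forall x, S x 0.
Hypothesis SB : forall x a b, S x a -> S x b -> S x (a - b).
Hypothesis SM : forall x y a b, S x a -> S y b -> S (x * y)%M (a * b).

Lemma graded_subring : subring graded_set.
Proof.
have SD x a b : S x a -> S x b -> S x (a + b).
  move=> Sa Sb; rewrite -[b]opprK; apply: SB => //.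
  by rewrite -sub0r; apply: SB.
split=> [|f g|f g].
- apply: mem_set => x; rewrite mcoeffC; case: eqP => [->//|_]; exact: S0.
- move=> /set_mem Gf /set_mem Gg; apply: mem_set => x.
  by rewrite mcoeffB; apply: SB.
- move=> /set_mem Gf /set_mem Gg; apply: mem_set => z; rewrite mcoeff_maM.
  elim/big_ind: _ => [//|u v|x _]; first exact: SD.
  elim/big_ind: _ => [//|u v|y _]; first exact: SD.
  by case: eqP => [<-|_]; [exact: SM|exact: S0].
Qed.

Let subG := graded_subring.

Lemma graded_mono a x : S x a -> graded_set (mono a x).
Proof. by move=> Sa y; rewrite mcoeffU; case: eqP => [<-|_] //; exact: S0. Qed.

Context (cancelN : cancellative N) (le : N -> N -> Prop).
Hypothesis le_order : translation_order le.
Hypothesis le_total : forall x y, le x y \/ le y x.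
Hypothesis S_closed :
  forall x b, S (x * x)%M (b * b) -> S (x * (x * x))%M (b * (b * b)) -> S x b.

Lemma exists_le_max (D : {fset N}) : D != fset0 ->
  exists2 n, n \in D & forall x, x \in D -> le x n.
Proof.
have [le_refl le_trans _ _] := le_order.
have max_seq (s : seq N) x :
    exists2 n, n \in x :: s & forall y, y \in x :: s -> le y n.
  elim: s x => [|y s IH] x.
    by exists x; rewrite ?mem_head // => y; rewrite inE => /eqP->.
  have [n ns maxn] := IH y; have [xn|nx] := le_total x n.
    exists n; first by rewrite inE ns orbT.
    by move=> z; rewrite inE => /orP[/eqP->|/maxn].
  exists x; first exact: mem_head.
  move=> z; rewrite inE => /orP[/eqP->|/maxn zn]; first exact: le_refl.
  exact: le_trans zn nx.
move=> /fset0Pn[x xD]; have : x \in enum_fset D by [].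
case E: (enum_fset D) => [//|y s] _.
by have [n ns maxn] := max_seq s y; exists n => [|z zD];
  [rewrite -[_ \in D]/(n \in enum_fset D) E|apply: maxn; rewrite -E].
Qed.

(** Squeeze: n m = x y <= n y <= n m, then cancel. *)
Lemma le_mmul_eq x y n m :
  le x n -> le y m -> (x * y = n * m)%M -> x = n /\ y = m.
Proof.
have [_ le_trans le_anti leM] := le_order => xn ym xy.
have ny : (n * y = n * m)%M.
  apply: le_anti; first by rewrite !(mulmC n); apply/leM.
  by rewrite -xy; apply/leM.
split; last exact: cancelN ny.
by apply: (cancelN (x := y)); rewrite !(mulmC y) xy ny.
Qed.

(** The bounds need not be attained. This matters for f^2, whose coefficient at n n can vanish when
    B is not reduced. *)
Lemma mcoeff_maM_max f g n m :
  (forall x, x \in msupp f -> le x n) -> (forall y, y \in msupp g -> le y m) ->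
  mcoeff (n * m)%M (f * g : R) = mcoeff n f * mcoeff m g.
Proof.
move=> maxf maxg.
have [nf|nf] := boolP (n \in msupp f); last first.
  rewrite (mcoeff_outdom nf) mul0r; apply: mcoeff_outdom.
  apply/negP => /msupp_maM[x [y [xf yg /esym xy]]].
  have [xn _] := le_mmul_eq (maxf _ xf) (maxg _ yg) xy.
  by rewrite -xn xf in nf.
rewrite {1}[f](ma_sum_mono f) mulr_suml raddf_sum /= (big_fsetD1 n) //=.
rewrite mcoeff_monoM // big1_fset ?addr0 // => x.
rewrite in_fsetD1 => /andP[xn xf] _; apply: mcoeff_outdom.
apply/negP => /msupp_maM[x' [y [x'x yg /esym xy]]].
move: x'x xy => /(fsubsetP msuppU_le); rewrite inE => /eqP-> xy.
have [xn' _] := le_mmul_eq (maxf _ xf) (maxg _ yg) xy.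
by rewrite xn' eqxx in xn.
Qed.

Lemma msupp_maM_le f g n m :
  (forall x, x \in msupp f -> le x n) -> (forall y, y \in msupp g -> le y m) ->
  forall z, z \in msupp (f * g : R) -> le z (n * m)%M.
Proof.
have [_ le_trans _ leM] := le_order => maxf maxg z.
move=> /msupp_maM[x [y [/maxf xn /maxg ym ->]]].
by apply: (le_trans _ (n * y)%M); [exact/leM|rewrite !(mulmC n); exact/leM].
Qed.

(* Once [u] is inverted, [f * f ^+ 2 = f ^+ 3] determines the coefficients of *)
(* [f] from the top down, as in a quotient of Laurent series.                 *)
Lemma lead_power_mul f n : graded_set (f ^+ 2) -> graded_set (f ^+ 3) ->
  (forall x, x \in msupp f -> le x n) ->
  graded_set (mono (mcoeff n f) n) ->
  power_conductor graded_set (mono (mcoeff n f) n) f.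
Proof.
move=> Gf2 Gf3 maxn; set u := mono _ n => Gu.
have max2 : forall x, x \in msupp (f ^+ 2) -> le x (n * n)%M.
  by rewrite expr2; exact: msupp_maM_le.
pose Q := power_conductor graded_set u.
suff Qmono x : x \in msupp f -> Q (mono (mcoeff x f) x).
  rewrite [X in power_conductor _ _ X](ma_sum_mono f).
  exact: (power_conductor_sum subG Gu).
move=> xf; apply: contrapT => not_Qx.
pose bad := [fset y in msupp f | `[< ~ Q (mono (mcoeff y f) y) >]]%fset.
have bad0 : bad != fset0.
  by apply/fset0Pn; exists x; rewrite !inE xf; apply/asboolP.
(* Take x to be the largest exponent whose term is not in [Q]. *)
have {x xf not_Qx bad0}[x] := exists_le_max bad0.
rewrite !inE => /andP[xf /asboolP not_Qx] maxx; apply: not_Qx.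
(* Since u counts as invertible in [Q], it suffices to treat u^2 times the term at x, which is what
   that term contributes to f * f^2 in degree x n n. *)
apply: (@power_conductor_cancel _ _ _ 2).
pose comp z (t : R) := mono (mcoeff z t) z.
have compD z : {morph comp z : s t / s + t}.
  by move=> s t; rewrite /comp mcoeffD /mono raddfD.
have comp0 z : comp z 0 = 0 by rewrite /comp mcoeff0 /mono raddf0.
pose z := (x * (n * n))%M.
pose rest := \sum_(y <- (msupp f `\ x)%fset)
  comp z (mono (mcoeff y f) y * f ^+ 2).
have comp_f3 : comp z (f ^+ 3) = u ^+ 2 * mono (mcoeff x f) x + rest.
  rewrite exprS {1}(ma_sum_mono f) mulr_suml (big_morph _ (compD z) (comp0 z)).
  rewrite (big_fsetD1 x) //=; congr (_ + _).
  rewrite /comp /z mcoeff_monoM // expr2 mcoeff_maM_max //.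
  by rewrite mulrC expr2 !monoM mulmC.
rewrite -(addrK rest (u ^+ 2 * _)) -comp_f3.
apply: (power_conductorB subG Gu).
  exact/power_conductor_sub/graded_mono.
apply: (power_conductor_sum subG Gu) => y.
rewrite in_fsetD1 => /andP[yx yf].
have [|zout] := boolP (z \in msupp (mono (mcoeff y f) y * f ^+ 2)); last first.
  rewrite /comp (mcoeff_outdom zout) /mono raddf0.
  exact/power_conductor_sub/(subring0 subG).
move=> /msupp_maM[y' [w [y'y wf2 zE]]].
move: y'y zE => /(fsubsetP msuppU_le); rewrite inE => /eqP-> zE.
rewrite /comp zE mcoeff_monoM // -monoM.
apply: (power_conductorM subG); last exact/graded_mono.
(* A bad y would satisfy y <= x; with w <= n n and y w = x n n this gives y = x, which [rest]
   excludes. *)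
apply: contrapT => not_Qy; have lyx : le y x.
  by apply: maxx; rewrite !inE yf; apply/asboolP.
have [yx' _] := le_mmul_eq lyx (max2 _ wf2) (esym zE).
by rewrite yx' eqxx in yx.
Qed.

Lemma graded_mem f :
  graded_set (f ^+ 2) -> graded_set (f ^+ 3) -> graded_set f.
Proof.
have [m] := ubnP #|` msupp f|; elim: m f => // m IH f.
rewrite ltnS => cardf Gf2 Gf3.
have [f0|] := eqVneq (msupp f) fset0.
  by move=> x; rewrite mcoeff_outdom ?f0 ?inE.
move=> /exists_le_max[n nf maxn]; set u := mono (mcoeff n f) n.
have Gu : graded_set u.
  apply/graded_mono/S_closed.
    by have := Gf2 (n * n)%M; rewrite expr2 mcoeff_maM_max.
  have := Gf3 (n * (n * n))%M; rewrite exprS expr2 !mcoeff_maM_max //.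
  exact: msupp_maM_le.
have cardfu : (#|` msupp (f - u)%R| < m)%N.
  apply: leq_trans cardf; apply: leq_trans (fproper_ltn_card (fproperD1 nf)).
  rewrite ltnS; apply/fsubset_leq_card/fsubsetP => x.
  rewrite in_fsetD1 -!mcoeff_neq0 mcoeffB mcoeffU [x == n]eq_sym.
  by have [<-|_] := eqVneq n x; rewrite ?mulr1n ?mulr0n ?subrr ?subr0 ?eqxx.
have [k] := lead_power_mul Gf2 Gf3 maxn Gu.
elim: k => [|k IHk]; first by rewrite expr0 mul1r.
move=> Gukf; apply: IHk; apply: (subring_descent subG Gu Gf2 Gf3 Gukf).
(* Multiplying by the monomial u does not increase the number of terms, so u^k (f - u) still has
   fewer terms than f. *)
apply: IH; elim: k {Gukf} => [|k IHk]; first by rewrite expr0 mul1r.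
by rewrite exprS -mulrA; apply: leq_ltn_trans IHk; exact: card_msupp_monoM.
Qed.

End GradedSubring.

(** * The two implications *)

Lemma not_reduced_square0 (B : comPzRingType) :
  ~ reduced B -> exists b : B, b != 0 /\ b * b = 0.
Proof.
move=> not_red; apply: contrapT => no_b; apply: not_red => b n.
elim: n => [|[|n] IH] bn0.
- by rewrite -[b]mul1r -(expr0 b) bn0 mul0r.
- by rewrite -[b]expr1.
(* If b^(n+2) = 0, then b^(n+1) squares to zero, so it is the witness unless it vanishes. *)
apply: IH; apply: contrapT => /eqP bn.
apply: no_b; exists (b ^+ n.+1); split=> //.
by rewrite -exprD addSnnS addnC exprD bn0 mul0r.
Qed.

Section Corollary.
Context {B : comPzRingType} {N : conomType} (A : set B) (M : set N).

(** When A contains 0, this is A for x in M and the zero set {0} otherwise. *)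
Definition monoid_algebra_part (x : N) : set B :=
  [set b | A b /\ (b != 0 -> M x)].

Lemma sub_monoid_algebra_graded : A 0 ->
  sub_monoid_algebra A M = graded_set monoid_algebra_part.
Proof.
move=> A0; apply/seteqP; split=> f.
  move=> [/allP Af Mf] x; split; last by rewrite mcoeff_neq0 => /Mf.
  by case: msuppP => // xf; exact/set_mem/(Af x xf).
move=> Gf; split; first by apply/allP => x _; apply/mem_set; case: (Gf x).
by move=> x /=; rewrite -mcoeff_neq0; case: (Gf x).
Qed.

End Corollary.

Theorem corollary1p3 (B : comPzRingType) (N : conomType)
    (A : set B) (M : set N) :
  cancellative N -> torsion_free N ->
  subring A -> submonoid M ->
  ring_subintegrally_closed A -> monoid_subintegrally_closed M ->
  (reduced B \/ M = setT ->
     ring_subintegrally_closed (sub_monoid_algebra A M)) /\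
  (ring_subintegrally_closed (sub_monoid_algebra A M) -> affine N ->
     reduced B \/ M = setT).
Proof.
move=> cancelN torsionN subA subM closedA closedM.
have [M1 MM] := subM; have A0 := subring0 subA.
have closedA' := (ring_subintegrally_closedP subA).1 closedA.
set S := monoid_algebra_part A M.
have S1 : S 1%M 1 by split=> [|_ //]; exact: subring1.
have S0 x : S x 0 by split; rewrite ?eqxx.
have SB x a b : S x a -> S x b -> S x (a - b).
  move=> [Aa Ma] [Ab Mb]; split; first exact: subringB.
  by have [->|/Ma//] := eqVneq a 0; rewrite sub0r oppr_eq0.
have SM x y a b : S x a -> S y b -> S (x * y)%M (a * b).
  move=> [Aa Ma] [Ab Mb]; split; first exact: subringM.
  have [->|/Ma Mx] := eqVneq a 0; first by rewrite mul0r eqxx.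
  have [->|/Mb My _] := eqVneq b 0; first by rewrite mulr0 eqxx.
  exact: MM.
have subG := graded_subring S1 S0 SB SM.
rewrite sub_monoid_algebra_graded // -/S ring_subintegrally_closedP //.
split=> [red_or_full|closedG _].
  have [le [le_order le_total]] := exists_total_order cancelN torsionN.
  move=> f; apply: (graded_mem S1 S0 SB SM cancelN le_order le_total).
  move=> x b [Ab2 Mx2] [Ab3 Mx3]; split; first exact: closedA'.
  case: red_or_full => [redB b0|->//].
  have bX n : b ^+ n != 0 by apply: contra_neq b0; exact: redB.
  by apply: (monoid_subintegrally_closed_mem subM closedM);
    [apply: Mx2; exact: (bX 2%N)|apply: Mx3; exact: (bX 3%N)].
apply: contrapT => /not_orP[/not_reduced_square0[b [b0 bb0]] not_full].
apply: not_full; apply/seteqP; split=> // x _.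
have mono0 y : mono 0 y = 0 :> monoid_algebra B N by rewrite /mono raddf0.
have bx2 : mono b x ^+ 2 = 0 :> monoid_algebra B N.
  by rewrite expr2 monoM bb0 mono0.
have /(_ x) [_] : graded_set S (mono b x).
  by apply: closedG; rewrite ?bx2 ?(exprS _ 2%N) ?bx2 ?mulr0;
    exact: (subring0 subG).
by rewrite mcoeffUU; apply.
Qed.
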